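(* For every formula $\psi\in\mathcal{L}_{pal}$, every Kripke model $\mathcal{M}$ and every world $w$ of $\mathcal{M}$, $$(\mathcal{M},w)\models\psi \iff (\mathcal{M},w)\models tr(\psi),$$ where $tr:\mathcal{L}_{pal}\to\mathcal{L}_{glal}$ is the translation that is the identity on atoms, commutes with $\neg$, $\land$ and $C_A$, and satisfies $tr([\phi]\phi')=[tr(\phi)]^+_{Ag}\,tr(\phi')$.
   Context: Languages. $AP$ is a set of atoms and $Ag$ a finite set of agents. For $p\in AP$ and $A\subseteq Ag$, the formulas of $\mathcal{L}_{glal}$ are $\psi ::= p \mid \neg\psi \mid \psi\land\psi \mid C_A\psi \mid [\psi]^+_A\psi \mid [\psi]^-_A\psi$, and the formulas of public announcement logic $\mathcal{L}_{pal}$ (PAL) are $\psi ::= p \mid \neg\psi \mid \psi\land\psi \mid C_A\psi \mid [\psi]\psi$. Models. A (Kripke) model is $\mathcal{M}=\langle W,\{R_a\}_{a\in Ag},V\rangle$ with $W$ a set of worlds, each $R_a$ an equivalence relation on $W$, and $V:AP\to 2^W$. For $w\in W$, $R_a(w)=\{w' : R_a(w,w')\}$; for $A\subseteq Ag$, $R^C_A=(\bigcup_{a\in A}R_a)^*$ is the reflexive-transitive closure and $R^C_A(w)=\{w' : R^C_A(w,w')\}$. Semantics. The satisfaction set $[\![\varphi]\!]_{\mathcal{M}}\subseteq W$ is defined by: $[\![p]\!]_{\mathcal{M}}=V(p)$; $[\![\neg\psi]\!]_{\mathcal{M}}=W\setminus[\![\psi]\!]_{\mathcal{M}}$; $[\![\psi\land\psi']\!]_{\mathcal{M}}=[\![\psi]\!]_{\mathcal{M}}\cap[\![\psi']\!]_{\mathcal{M}}$;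 $[\![C_A\psi]\!]_{\mathcal{M}}=\{w : R^C_A(w)\subseteq[\![\psi]\!]_{\mathcal{M}}\}$; for $\star\in\{+,-\}$, $[\![[\psi]^\star_A\psi']\!]_{\mathcal{M}}=\{w : \text{if } w\in[\![\psi]\!]_{\mathcal{M}} \text{ then } w\in[\![\psi']\!]_{\mathcal{M}^\star_{(w,\psi,A)}}\}$; and $[\![[\psi]\psi']\!]_{\mathcal{M}}=\{w : \text{if } w\in[\![\psi]\!]_{\mathcal{M}} \text{ then } w\in[\![\psi']\!]_{\mathcal{M}_\psi}\}$. The refinements $\mathcal{M}^-_{(w,\psi,A)}$ and $\mathcal{M}^+_{(w,\psi,A)}$ have the same worlds and valuation as $\mathcal{M}$ and relations $R^-_b=R^+_b=R_b$ for $b\notin A$, while for $a\in A$: $R^-_a(v)=R_a(v)\cap[\![\psi]\!]_{\mathcal{M}}$ if $v\in R_a(w)\cap[\![\psi]\!]_{\mathcal{M}}$; $R^-_a(v)=R_a(v)\cap[\![\neg\psi]\!]_{\mathcal{M}}$ if $v\in R_a(w)\cap[\![\neg\psi]\!]_{\mathcal{M}}$; $R^-_a(v)=R_a(v)$ otherwise; and $R^+_a(v)$ is defined by the same three cases with $R_a(w)$ replaced by $R^C_A(w)$ in the case conditions. The model $\mathcal{M}_\psi$ is the restriction of $\mathcal{M}$ to $[\![\psi]\!]_{\mathcal{M}}$: its worlds are $W\cap[\![\psi]\!]_{\mathcal{M}}$, its relations $R_a\cap([\![\psi]\!]_{\mathcal{M}}\times[\![\psi]\!]_{\mathcal{M}})$,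 its valuation $p\mapsto V(p)\cap[\![\psi]\!]_{\mathcal{M}}$. We write $(\mathcal{M},w)\models\varphi$ for $w\in[\![\varphi]\!]_{\mathcal{M}}$. *)

(* Defs.v *)
From mathcomp Require Import all_boot.
From mathcomp Require Import boolp classical_sets.
From Stdlib Require Import Relations.

Set Implicit Arguments.
Unset Strict Implicit.
Unset Printing Implicit Defensive.

Local Open Scope classical_set_scope.

Inductive glal (AP : Type) (Ag : finType) : Type :=
| GAtom of AP
| GNeg of glal AP Ag
| GAnd of glal AP Ag & glal AP Ag
| GCommon of {set Ag} & glal AP Ag
| GPlus of {set Ag} & glal AP Ag & glal AP Ag
| GMinus of {set Ag} & glal AP Ag & glal AP Ag.

Inductive pal (AP : Type) (Ag : finType) : Type :=
| PAtom of AP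
| PNeg of pal AP Ag
| PAnd of pal AP Ag & pal AP Ag
| PCommon of {set Ag} & pal AP Ag
| PAnnounce of pal AP Ag & pal AP Ag.

Arguments GAtom {AP Ag}.
Arguments PAtom {AP Ag}.

(* [acc M a w] is the set R_a(w), so [acc M a w w'] is the proposition
   R_a(w, w'). *)
Record model (AP : Type) (Ag : finType) : Type := Model {
  world : Type;
  acc : Ag -> world -> set world;
  valuation : AP -> set world;
  acc_equiv : forall a, equivalence world (acc a) }.

Arguments acc {AP Ag}.
Arguments valuation {AP Ag}.

Definition common_acc AP Ag (M : model AP Ag) (A : {set Ag}) (w : world M) :
    set (world M) :=
  clos_refl_trans (world M) (fun u v => exists2 a, a \in A & acc M a u v) w.

(* The three-case redefinition of r(v) common to both refinements: D is the
   region where the case conditions apply, and X is the set of worlds satisfying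
   the announced formula. *)
Definition split_acc T (r : T -> set T) (D X : set T) (v : T) : set T :=
  if v \in D `&` X then r v `&` X
  else if v \in D `&` ~` X then r v `&` ~` X
  else r v.

Lemma split_acc_equiv T (r : T -> set T) (D X : set T) :
  equivalence T r -> (forall u v, r u v -> D u -> D v) ->
  equivalence T (split_acc r D X).
Proof.
move=> [rr rt rs] rD.
have E u v : split_acc r D X u v <-> r u v /\ (D u -> (X u <-> X v)).
  rewrite /split_acc; case: ifPn => [/set_mem[Du Xu]|/negP nX].
    by split=> [[ruv Xv]|[ruv /(_ Du)[h _] ]]; split=> //; exact: h.
  case: ifPn => [/set_mem[Du nXu]|/negP nnX].
    split=> [[ruv nXv]|[ruv /(_ Du)[_ h] ]]; split=> //.
    by move=> Xv; apply: nXu; exact: h.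
  split=> [ruv|[]//]; split=> // Du; case: (EM (X u)) => Xu.
    by case: nX; exact: mem_set.
  by case: nnX; exact: mem_set.
split.
- by move=> u; apply/E; split.
- move=> u v w /E[ruv huv] /E[rvw hvw]; apply/E; split; first exact: rt rvw.
  by move=> Du; rewrite (huv Du); apply: hvw; exact: rD Du.
- move=> u v /E[ruv huv]; apply/E; split; first exact: rs.
  by move=> Dv; rewrite huv //; apply: rD Dv; exact: rs.
Qed.

Section Refinements.
Variables (AP : Type) (Ag : finType) (M : model AP Ag).
Variables (w : world M) (X : set (world M)) (A : {set Ag}).

Definition plus_acc (a : Ag) : world M -> set (world M) :=
  if a \in A then split_acc (acc M a) (common_acc A w) X else acc M a.

Definition minus_acc (a : Ag) : world M -> set (world M) :=
  if a \in A then split_acc (acc M a) (acc M a w) X else acc M a.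

Definition restrict_acc (a : Ag) (u : set_type X) : set (set_type X) :=
  [set v | acc M a (val u) (val v)].

Lemma plus_acc_equiv a : equivalence (world M) (plus_acc a).
Proof.
have eqa := acc_equiv M a; rewrite /plus_acc; case: ifPn => // aA.
apply: split_acc_equiv => // u v ruv wu.
by apply: rt_trans wu _; apply: rt_step; exists a.
Qed.

Lemma minus_acc_equiv a : equivalence (world M) (minus_acc a).
Proof.
have eqa := acc_equiv M a; rewrite /minus_acc; case: ifPn => // aA.
by apply: split_acc_equiv => // u v ruv wu; apply: equiv_trans wu ruv.
Qed.

Lemma restrict_acc_equiv a : equivalence (set_type X) (restrict_acc a).
Proof.
have [rr rt rs] := acc_equiv M a.
by split=> [u|u v t|u v]; [exact: rr|exact: rt|exact: rs].
Qed.

Definition refine_plus : model AP Ag :=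
  @Model AP Ag (world M) plus_acc (valuation M) plus_acc_equiv.

Definition refine_minus : model AP Ag :=
  @Model AP Ag (world M) minus_acc (valuation M) minus_acc_equiv.

Definition restrict : model AP Ag :=
  @Model AP Ag (set_type X) restrict_acc
    (fun p => [set v | valuation M p (val v)]) restrict_acc_equiv.

End Refinements.

Arguments refine_plus {AP Ag} M w X A.
Arguments refine_minus {AP Ag} M w X A.
Arguments restrict {AP Ag} M X.

Unset Implicit Arguments.

Fixpoint glal_sat {AP : Type} {Ag : finType} (psi : glal AP Ag) :
    forall M : model AP Ag, set (world M) :=
  match psi with
  | GAtom p => fun M => valuation M p
  | GNeg f => fun M => ~` glal_sat f M
  | GAnd f g => fun M => glal_sat f M `&` glal_sat g M
  | GCommon A f => fun M => [set w | common_acc A w `<=` glal_sat f M]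
  | GPlus A f g => fun M =>
      [set w | glal_sat f M w ->
               glal_sat g (refine_plus M w (glal_sat f M) A) w]
  | GMinus A f g => fun M =>
      [set w | glal_sat f M w ->
               glal_sat g (refine_minus M w (glal_sat f M) A) w]
  end.

(* The worlds of the restricted model form a subtype, so a world [w] satisfying
   the announced formula is transported there together with its proof [fw]. *)
Fixpoint pal_sat {AP : Type} {Ag : finType} (psi : pal AP Ag) :
    forall M : model AP Ag, set (world M) :=
  match psi with
  | PAtom p => fun M => valuation M p
  | PNeg f => fun M => ~` pal_sat f M
  | PAnd f g => fun M => pal_sat f M `&` pal_sat g M
  | PCommon A f => fun M => [set w | common_acc A w `<=` pal_sat f M]
  | PAnnounce f g => fun M =>
      [set w | forall fw : w \in pal_sat f M,
               pal_sat g (restrict M (pal_sat f M)) (SigSub fw)]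
  end.

Fixpoint tr {AP : Type} {Ag : finType} (psi : pal AP Ag) : glal AP Ag :=
  match psi with
  | PAtom p => GAtom p
  | PNeg f => GNeg (tr f)
  | PAnd f g => GAnd (tr f) (tr g)
  | PCommon A f => GCommon A (tr f)
  | PAnnounce f g => GPlus [set: Ag]%SET (tr f) (tr g)
  end.

(* Main.v *)
Require Import Defs.
From mathcomp Require Import all_boot.
From mathcomp Require Import boolp classical_sets.
From Stdlib Require Import Relations.

(** PAL is invariant under bisimulation. After announcing [X] at [w], every
    world of [X] that is commonly accessible from [w] keeps exactly its
    [X]-successors in the refinement for the full set of agents, so there the
    refinement is bisimilar, via the inclusion, to the restriction to [X].
    Hence the translation preserves truth, by induction on the formula. *)

Set Implicit Arguments.
Unset Strict Implicit.
Unset Printing Implicit Defensive.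

Local Open Scope classical_set_scope.

Section Bisimulation.
Variables (AP : Type) (Ag : finType).
Implicit Types M N : model AP Ag.

Definition simulation M N (Z : world M -> world N -> Prop) : Prop :=
  forall a u v u', Z u u' -> acc M a u v -> exists2 v', acc N a u' v' & Z v v'.

Definition bisimulation M N (Z : world M -> world N -> Prop) : Prop :=
  [/\ forall p u u', Z u u' -> valuation M p u <-> valuation N p u',
      simulation Z & simulation (fun u' u => Z u u')].

(** A step of an agent in [A] is matched by a step of the same agent, and matched steps concatenate
    along the closure. *)
Lemma simulation_common M N (Z : world M -> world N -> Prop) A u v u' :
  simulation Z -> Z u u' -> common_acc A u v ->
  exists2 v', common_acc A u' v' & Z v v'.
Proof.
move=> simZ + uv; elim: uv u' => {u v} [u v [a aA uv]|u|u v t _ IHuv _ IHvt] u' uu'.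
- have [v' uv' vv'] := simZ _ _ _ _ uu' uv.
  by exists v' => //; apply: rt_step; exists a.
- by exists u' => //; exact: rt_refl.
- have [v' uv' vv'] := IHuv _ uu'; have [t' vt' tt'] := IHvt _ vv'.
  by exists t' => //; exact: rt_trans vt'.
Qed.

(** The matching successor survives the restriction because it is related to a world of [X] and so
    lies in [Y]. *)
Lemma simulation_restrict M N (Z : world M -> world N -> Prop)
    (X : set (world M)) (Y : set (world N)) :
  (forall u u', Z u u' -> X u -> Y u') -> simulation Z ->
  @simulation (restrict M X) (restrict N Y) (fun u u' => Z (val u) (val u')).
Proof.
move=> XY simZ a u v u' uu' uv; have [v' uv' vv'] := simZ _ _ _ _ uu' uv.
have Yv' : v' \in Y by apply/mem_set/(XY _ _ vv')/set_mem/valP.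
by exists (SigSub Yv').
Qed.

(** The induction ranges over all models and relations because an announcement changes both: the
    hypothesis for [f] at [Z] shows that [Z] respects the announced sets, and the one for [g] is
    applied to [Z] between the restricted models. *)
Lemma bisimulation_pal_sat psi M N (Z : world M -> world N -> Prop) u u' :
  bisimulation Z -> Z u u' -> pal_sat psi M u <-> pal_sat psi N u'.
Proof.
elim: psi M N Z u u' => [p|f IHf|f IHf g IHg|A f IHf|f IHf g IHg] M N Z u u'
  bisZ uu' /=; have [VZ forth back] := bisZ.
- exact: VZ.
- by have := IHf _ _ _ _ _ bisZ uu'; rewrite /setC /=; tauto.
- have := IHf _ _ _ _ _ bisZ uu'; have := IHg _ _ _ _ _ bisZ uu'.
  by rewrite /setI /=; tauto.
- split=> h v uv.
  + have [t ut tv] := simulation_common back uu' uv.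
    exact/(IHf _ _ _ _ _ bisZ tv)/h.
  + have [t ut vt] := simulation_common forth uu' uv.
    exact/(IHf _ _ _ _ _ bisZ vt)/h.
- have ff v v' : Z v v' -> pal_sat f M v <-> pal_sat f N v' by exact: IHf bisZ.
  have bisR : @bisimulation (restrict M (pal_sat f M)) (restrict N (pal_sat f N))
      (fun v v' => Z (val v) (val v')).
    split; first by move=> p v v'; exact: VZ.
    + by apply: simulation_restrict forth => v v' /ff[].
    + by apply: (simulation_restrict _ back) => v' v /ff[].
  (* The membership proofs are arbitrary: the relation between restricted models sees only the
     underlying worlds, so [uu'] serves for all of them. *)
  have gg (fu : u \in pal_sat f M) (fu' : u' \in pal_sat f N) :
      pal_sat g (restrict M _) (SigSub fu) <-> pal_sat g (restrict N _) (SigSub fu').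
    exact: (IHg (restrict M _) (restrict N _) _ (SigSub fu) (SigSub fu') bisR uu').
  split=> h fw.
  + have fu : u \in pal_sat f M by apply/mem_set/(ff _ _ uu')/set_mem.
    exact/(gg fu)/h.
  + have fu' : u' \in pal_sat f N by apply/mem_set/(ff _ _ uu')/set_mem.
    exact/(gg _ fu')/h.
Qed.

(** Reachability from [w] is part of the relation because an unreachable world of [X] keeps its
    successors outside [X], which the restriction lacks. With all agents in the group, no step
    leaves the reachable region. *)
Lemma bisimulation_restrict_refine_plus M (w : world M) (X : set (world M)) :
  @bisimulation (restrict M X) (refine_plus M w X [set: Ag]%SET)
    (fun u v => val u = v /\ common_acc [set: Ag]%SET w v).
Proof.
set D := common_acc [set: Ag]%SET w.
have stepD a u v : D u -> acc M a u v -> D v.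
  by move=> Du uv; apply: rt_trans Du _; apply: rt_step; exists a; rewrite ?inE.
(* On reachable worlds of [X] only the first case of [split_acc] applies. *)
have plusE a u v : D u -> X u ->
    plus_acc w X [set: Ag]%SET a u v <-> acc M a u v /\ X v.
  move=> Du Xu; rewrite /plus_acc finset.in_setT /split_acc ifT //.
  exact: mem_set.
split.
- by move=> p u v [<- _].
- move=> a u v _ [<- Du] uv; exists (val v); last by split=> //; exact: stepD uv.
  by apply/(plusE _ _ _ Du (set_mem (valP u))); split=> //; exact/set_mem/valP.
- move=> a _ v u [<- Du] /(plusE _ _ _ Du (set_mem (valP u)))[uv /mem_set Xv].
  by exists (SigSub Xv) => //; split=> //; exact: stepD uv.
Qed.

Lemma pal_sat_restrict psi M (w : world M) (X : set (world M)) (wX : w \in X) :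
  pal_sat psi (restrict M X) (SigSub wX) <->
  pal_sat psi (refine_plus M w X [set: Ag]%SET) w.
Proof.
apply: (@bisimulation_pal_sat _ (restrict M X) (refine_plus M w X _) _
          (SigSub wX) w (bisimulation_restrict_refine_plus w X)).
by split=> //; exact: rt_refl.
Qed.

End Bisimulation.

Theorem proposition2 (AP : Type) (Ag : finType) (psi : pal AP Ag)
    (M : model AP Ag) (w : world M) :
  pal_sat psi M w <-> glal_sat (tr psi) M w.
Proof.
elim: psi M w => [p|f IHf|f IHf g IHg|A f IHf|f IHf g IHg] M w //=.
- by have := IHf M w; rewrite /setC /=; tauto.
- by have := IHf M w; have := IHg M w; rewrite /setI /=; tauto.
- by split=> h v /h /IHf.
(* The refined model takes the announced set as a parameter, so equality of sets is needed to
   rewrite inside it. *)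
- have <- : pal_sat f M = glal_sat (tr f) M.
    by apply/funext => v; apply/propext; exact: IHf.
  (* The hypothesis for [g] is used at the refined model; [pal_sat_restrict] then passes between it
     and the restriction. *)
  split=> [h fw|h fw].
  + exact/IHg/(pal_sat_restrict g (mem_set fw)).
  + exact/pal_sat_restrict/IHg/h/set_mem.
Qed.
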